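(* Let $A\in\mathbb{R}^{n_x\times n_x}$, $D\in\mathbb{R}^{n_x\times n_v}$, $E\in\mathbb{R}^{n_x\times n_w}$, $\Sigma_w\in\mathbb{R}^{n_w\times n_w}$ with $\Sigma_w\succ 0$, $\varepsilon\in(0,1)$ and $d\ge 0$. Consider the discrete-time linear stochastic system $x_{t+1}=Ax_t+Dv_t+Ew_t$, $t\in\mathbb{Z}_{\ge 0}$, with bounded inputs $v_t\in\mathcal{V}=\{v\in\mathbb{R}^{n_v}:\|v\|\le d\}$, and assume that $\|A\|<1$ and $(A,E)$ is reachable. For $r>0$ define $\mathcal{D}=\{x\in\mathbb{R}^{n_x}:\|x\|^2-r^2\le 0\}$. If $$r^2\ge\frac{1}{(1-\|A\|)^2}\left(\|D\|d+\sqrt{\frac1\varepsilon\operatorname{Tr}(\Sigma_wE^\top E)}\right)^2,$$ then $\mathcal{D}$ is a worst-case CVaR robust positively invariant set for the system, i.e., for any state $x_t\in\mathcal{D}$ and any inputs with values in $\mathcal{V}$, $$\sup_{\mathbb{P}\in\mathcal{P}_k}\mathbb{P}\text{-CVaR}_\varepsilon[\|x_{t+k}\|^2-r^2]\le 0\quad\text{for all } k\in\mathbb{Z}_{>0}.$$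
   Context: $\|\cdot\|$ is the Euclidean norm on vectors and the maximum singular value on matrices; $M\succ 0$ means positive definite. Reachability of $(A,E)$ means $\operatorname{rank}[E, AE,\dots,A^{n_x-1}E]=n_x$. CVaR: for a probability distribution $\mathbb{P}$ of a random vector $\xi$ and a measurable loss $L$, at level $\varepsilon\in(0,1)$, $\mathbb{P}\text{-CVaR}_\varepsilon[L(\xi)]=\inf_{\beta\in\mathbb{R}}\{\beta+\frac1\varepsilon\mathbb{E}_{\mathbb{P}}[(L(\xi)-\beta)^+]\}$, where $x^+=\max\{x,0\}$. The worst-case CVaR over a set of distributions is the supremum of CVaR over that set. Setting: the disturbances $w_t\in\mathbb{R}^{n_w}$ are i.i.d. with mean zero and covariance $\Sigma_w$, but their distribution is otherwise unknown. $\mathcal{P}_k$ is the set of all probability distributions on $\mathbb{R}^{n_wk}$ with mean zero and covariance $I_k\otimes\Sigma_w$. The inputs are treated as an arbitrary bounded disturbance with values in $\mathcal{V}$. Definition: for a continuous $f:\mathbb{R}^{n_x}\to\mathbb{R}$, the set $\mathcal{D}=\{x: f(x)\le 0\}$ is a worst-case CVaR robust positively invariant set if for any state $x_t\in\mathcal{D}$ one has $\sup_{\mathbb{P}\in\mathcal{P}_k}\mathbb{P}\text{-CVaR}_\varepsilon[f(x_{t+k})]\le 0$ for all $k\in\mathbb{Z}_{>0}$ (for all admissible inputs). Here $x_t$ is regarded as a given (deterministic) vector, $x_{t+k}=A^kx_t+\sum_{j=0}^{k-1}A^{k-1-j}(Dv_{t+j}+Ew_{t+j})$, the input $v_{t+j}\in\mathcal{V}$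 may depend (measurably) on $w_t,\dots,w_{t+j-1}$, and the law of the stacked disturbance $[w_t^\top,\dots,w_{t+k-1}^\top]^\top$ ranges over $\mathcal{P}_k$. In the claim $f(x)=\|x\|^2-r^2$. *)

(* Defs.v *)
From HB Require Import structures.
From mathcomp Require Export all_boot all_order all_algebra.
From mathcomp Require Export mxtens.
From mathcomp Require Export all_classical all_reals all_analysis.

Set Implicit Arguments.
Unset Strict Implicit.
Unset Printing Implicit Defensive.

Import Order.TTheory GRing.Theory Num.Theory.
Import numFieldNormedType.Exports.

Local Open Scope classical_set_scope.
Local Open Scope ring_scope.

(* The library norm on matrices is the max norm, hence a separate Euclidean
   norm; the induced topology on ['cV[R]_n] is the same. *)
Definition enorm (R : realType) (n : nat) (x : 'cV[R]_n) : R :=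
  Num.sqrt (\sum_(i < n) x i 0 ^+ 2).

(* When m < n this set may contain 0 in addition to the usual min(m, n)
   singular values, which does not affect the largest one. *)
Definition singular_values (R : realType) (m n : nat) (M : 'M[R]_(m, n)) :
    set R :=
  [set s | 0 <= s /\ eigenvalue (M^T *m M) (s ^+ 2)].

(* The set is finite, so [sup] is a maximum; it is 0 when n = 0. *)
Definition max_singular_value (R : realType) (m n : nat) (M : 'M[R]_(m, n)) :
    R :=
  sup (singular_values M).

Definition posdef (R : realType) (n : nat) (M : 'M[R]_n) : Prop :=
  M^T = M /\ forall x : 'cV[R]_n, x != 0 -> 0 < (x^T *m M *m x) 0 0.

(* The argument of [\rank] is the block row [E, AE, ..., A^(nx-1) E]. *)
Definition reachable (R : realType) (nx nw : nat)
    (A : 'M[R]_nx) (E : 'M[R]_(nx, nw)) : Prop :=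
  \rank (\mxrow_(i < nx) (A ^+ i *m E)) = nx.

(* R^n with its product (equivalently, Borel) sigma-algebra. *)
Notation Rvec R n := (n.-tuple (measurableTypeR R)).

(* Extended-real valued: no integrability of the loss is presupposed. *)
Definition CVaR (R : realType) (d : measure_display) (T : measurableType d)
    (P : probability T R) (eps : R) (L : T -> R) : \bar R :=
  ereal_inf [set (beta%:E
                  + (eps^-1)%:E * 'E_P[fun w => Num.max (L w - beta)%R 0%R])%E
            | beta in [set: R]].

(* Finite second moments are required explicitly, so that the means and
   covariances are those of square-integrable coordinates. *)
Definition moment_set (R : realType) (n : nat) (C : 'M[R]_n) :
    set (probability (Rvec R n) R) :=
  [set P : probability (Rvec R n) R |
     [/\ forall i, (fun w : Rvec R n => tnth w i : R) \in Lfun P 2%:E,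
         forall i, ('E_P[fun w : Rvec R n => tnth w i] = 0)%E
       & forall i j,
           covariance P (fun w : Rvec R n => tnth w i)
                        (fun w : Rvec R n => tnth w j) = (C i j)%:E]].

(* [*t] is the Kronecker product; the stacked disturbance
   [w_t; ...; w_(t+k-1)] has its component [w_(t+j)] at positions
   j * nw, ..., j * nw + nw - 1. *)
Definition ambiguity_set (R : realType) (nw : nat) (Sigma : 'M[R]_nw)
    (k : nat) : set (probability (Rvec R (k * nw)) R) :=
  moment_set ((1%:M : 'M[R]_k) *t Sigma).
Arguments ambiguity_set {R nw} Sigma k _.

(* [disturbance w j] is the j-th block of the stacked vector w, for j < k. *)
Definition disturbance (R : realType) (nw k : nat) (w : Rvec R (k * nw))
    (j : nat) : 'cV[R]_nw :=
  \col_(i < nw) nth 0 w (j * nw + i).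

(* [history w j] stacks the first j blocks of w, for j <= k. *)
Definition history (R : realType) (nw k : nat) (w : Rvec R (k * nw))
    (j : nat) : Rvec R (j * nw) :=
  [tuple nth 0 w i | i < j * nw].

(* The j-th input is a function of the first j disturbances only. *)
Definition policy (R : realType) (nw nv : nat) : Type :=
  forall j : nat, Rvec R (j * nw) -> 'cV[R]_nv.

Definition admissible (R : realType) (nw nv : nat) (V : set 'cV[R]_nv)
    (v : policy R nw nv) : Prop :=
  forall j : nat,
    (forall h, V (v j h)) /\
    (forall i, measurable_fun [set: Rvec R (j * nw)]
                 (fun h => v j h i 0 : measurableTypeR R)).

Fixpoint trajectory (R : realType) (nx nv nw : nat) (A : 'M[R]_nx)
    (D : 'M[R]_(nx, nv)) (E : 'M[R]_(nx, nw)) (x : 'cV[R]_nx)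
    (v : nat -> 'cV[R]_nv) (w : nat -> 'cV[R]_nw) (k : nat) : 'cV[R]_nx :=
  if k is j.+1 then A *m trajectory A D E x v w j + D *m v j + E *m w j else x.

(* The state k steps after x, as a function of the stacked disturbance. *)
Definition state_after (R : realType) (nx nv nw : nat) (A : 'M[R]_nx)
    (D : 'M[R]_(nx, nv)) (E : 'M[R]_(nx, nw)) (x : 'cV[R]_nx)
    (v : policy R nw nv) (k : nat) (w : Rvec R (k * nw)) : 'cV[R]_nx :=
  trajectory A D E x (fun j => v j (history w j)) (disturbance w) k.

(* Worst-case CVaR robust positive invariance of {x | f x <= 0}.  The system
   and the ambiguity sets are time-invariant, so the initial time is not
   recorded. *)
Definition wc_CVaR_invariant (R : realType) (nx nv nw : nat) (A : 'M[R]_nx)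
    (D : 'M[R]_(nx, nv)) (E : 'M[R]_(nx, nw)) (Sigma : 'M[R]_nw)
    (V : set 'cV[R]_nv) (eps : R) (f : 'cV[R]_nx -> R) : Prop :=
  continuous f /\
  forall x, f x <= 0 ->
  forall v : policy R nw nv, admissible V v ->
  forall k : nat, (0 < k)%N ->
    (ereal_sup [set CVaR P eps (fun w => f (state_after A D E x v w))
               | P in ambiguity_set Sigma k] <= 0)%E.

(* Main.v *)
(** Write [a = ||A||], [delta = ||D|| d] and [q = sqrt (Tr (Sigma E^T E) / eps)],
    so that the hypothesis on [r] reads [delta + q <= (1 - a) r].  Convexity of
    the square with weights [a], [1 - a], and Cauchy-Schwarz in the form
    [(delta + e)^2 <= (delta + q) (delta + e^2 / q)], give the pathwise bound
    [|x_{j+1}|^2 <= a |x_j|^2 + r (delta + |E w_j|^2 / q)].  Unrolling it splits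
    [|x_k|^2 - r^2] into a constant plus a nonnegative quadratic function of the
    disturbances with known mean; taking the constant as [beta] in the
    definition of CVaR leaves exactly
    [a^k r^2 + (1 - a^k) / (1 - a) r (delta + q) - r^2 <= 0].
    If [q = 0], positive definiteness of [Sigma] forces [E = 0].
    The bound [|M x| <= ||M|| |x|] comes from maximising the Rayleigh quotient of
    [M^T M] on the sphere: a maximiser is isotropic for the positive
    semidefinite form [mu I - M^T M], hence an eigenvector. *)
Require Import Defs.
From mathcomp Require Import ring lra.

Set Implicit Arguments.
Unset Strict Implicit.
Unset Printing Implicit Defensive.

Import Order.TTheory GRing.Theory Num.Theory.
Import numFieldNormedType.Exports.

Local Open Scope classical_set_scope.
Local Open Scope ring_scope.

(** * Symmetric bilinear forms on row vectors and Cauchy-Schwarz *)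

Definition bilin (R : realType) (n : nat) (S : 'M[R]_n) (u v : 'rV[R]_n) : R :=
  (u *m S *m v^T) 0 0.

Lemma bilinE (R : realType) n (S : 'M[R]_n) (u v : 'rV[R]_n) :
  bilin S u v = \sum_i \sum_j u 0 i * S i j * v 0 j.
Proof.
rewrite /bilin mxE exchange_big /=; apply: eq_bigr => j _.
by rewrite !mxE mulr_suml.
Qed.

Lemma bilinC (R : realType) n (S : 'M[R]_n) (u v : 'rV[R]_n) :
  S^T = S -> bilin S u v = bilin S v u.
Proof.
move=> hS; have -> : bilin S u v = (u *m S *m v^T)^T 0 0 by rewrite mxE.
by rewrite !trmx_mul trmxK hS mulmxA.
Qed.

Lemma bilinDZ (R : realType) n (S : 'M[R]_n) (t : R) (u v : 'rV[R]_n) :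
  S^T = S -> bilin S (t *: u + v) (t *: u + v) =
  t ^+ 2 * bilin S u u + 2 * t * bilin S u v + bilin S v v.
Proof.
move=> hS; have := bilinC u v hS; rewrite /bilin.
rewrite linearD linearZ /= !mulmxDl !mulmxDr -!scalemxAl -!scalemxAr.
by rewrite !mxE => ->; ring.
Qed.

Lemma bilin1E (R : realType) n (u v : 'rV[R]_n) :
  bilin 1%:M u v = \sum_i u 0 i * v 0 i.
Proof. by rewrite /bilin mulmx1 mxE; apply: eq_bigr => i _; rewrite mxE. Qed.

Lemma bilin1_ge0 (R : realType) n (u : 'rV[R]_n) : 0 <= bilin 1%:M u u.
Proof. by rewrite bilin1E sumr_ge0// => i _; rewrite -expr2 sqr_ge0. Qed.

Lemma bilin1_eq0 (R : realType) n (u : 'rV[R]_n) :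
  (bilin 1%:M u u == 0) = (u == 0).
Proof.
apply/eqP/eqP => [|->]; last by rewrite /bilin !mul0mx mxE.
rewrite bilin1E => /eqP; rewrite psumr_eq0 => [/allP h|i _]; last first.
  by rewrite -expr2 sqr_ge0.
apply/rowP => i; rewrite mxE; apply/eqP.
by rewrite -sqrf_eq0 expr2; apply: h; rewrite mem_index_enum.
Qed.

(** Discriminant argument: the form at [t *: u + v] is a nonnegative quadratic polynomial in [t].
    Its leading coefficient may vanish, as [S] is only semidefinite. *)
Lemma bilin_CauchySchwarz (R : realType) n (S : 'M[R]_n) (u v : 'rV[R]_n) :
  S^T = S -> (forall w, 0 <= bilin S w w) ->
  bilin S u v ^+ 2 <= bilin S u u * bilin S v v.
Proof.
move=> hS S0; have u0 := S0 u; have v0 := S0 v.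
have h t : 0 <= t ^+ 2 * bilin S u u + 2 * t * bilin S u v + bilin S v v.
  by rewrite -bilinDZ.
move: (bilin S u u) (bilin S u v) (bilin S v v) h u0 v0 => a b c h a0 c0.
have [a1|a1] := eqVneq a 0.
  have [->|b0] := eqVneq b 0; first by rewrite expr0n mulr_ge0.
  (* With [a = 0] the polynomial is affine in [t]; this [t] gives it the value [-1]. *)
  have := h (- (c + 1) / (2 * b)).
  have -> : 2 * (- (c + 1) / (2 * b)) * b = - (c + 1) by field.
  by rewrite a1; lra.
(* The minimiser of the polynomial. *)
have := h (- b / a).
have -> : (- b / a) ^+ 2 * a + 2 * (- b / a) * b + c = (a * c - b ^+ 2) / a.
  by field.
by rewrite pmulr_lge0 ?invr_gt0 ?lt_def ?a1// subr_ge0.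
Qed.

(** Cauchy-Schwarz against each basis vector kills the corresponding coordinate of [u *m S]. *)
Lemma bilin_isotropic (R : realType) n (S : 'M[R]_n) (u : 'rV[R]_n) :
  S^T = S -> (forall w, 0 <= bilin S w w) -> bilin S u u = 0 -> u *m S = 0.
Proof.
move=> hS S0 u0; apply/rowP => i; rewrite [RHS]mxE.
have := bilin_CauchySchwarz u (delta_mx 0 i) hS S0.
rewrite u0 mul0r => h.
have /eqP : bilin S u (delta_mx 0 i) == 0 by rewrite -sqrf_eq0 eq_le h sqr_ge0.
rewrite /bilin trmx_delta mxE (bigD1 i)//= big1 ?addr0 => [|j ji].
  by rewrite !mxE !eqxx mulr1.
by rewrite [delta_mx _ _ _ _]mxE (negPf ji) mulr0.
Qed.

(** * Rayleigh quotients on the compact unit sphere *)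

Lemma continuous_sumr (R : realType) (T : topologicalType) (I : Type)
    (s : seq I) (f : I -> T -> R) :
  (forall i, continuous (f i)) -> continuous (fun x => \sum_(i <- s) f i x).
Proof.
move=> cf; elim: s => [|i s IH] x.
  by under eq_fun do rewrite big_nil; exact: cvg_cst.
under eq_fun do rewrite big_cons.
by apply: cvgD; [exact: cf|exact: IH].
Qed.

Lemma continuous_bilin (R : realType) n (S : 'M[R]_n) :
  continuous (fun u : 'rV[R]_n => bilin S u u).
Proof.
under eq_fun do rewrite bilinE.
apply: continuous_sumr => i; apply: continuous_sumr => j u.
apply: (@continuousM _ _ (fun u : 'rV[R]_n => u 0 i * S i j) (fun u => u 0 j)).
  apply: (@continuousM _ _ (fun u : 'rV[R]_n => u 0 i) (fun=> S i j)).
    exact: coord_continuous.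
  exact: cst_continuous.
exact: coord_continuous.
Qed.

Lemma compact_sphere (R : realType) n :
  compact [set u : 'rV[R]_n | bilin 1%:M u u = 1].
Proof.
apply: bounded_closed_compact.
  exists 1; split => // M M1 u /= u1.
  rewrite [leLHS]/Num.norm /= mx_normrE; apply/bigmax_leP; split => [|[k i] _ /=].
    by rewrite ltW// (lt_trans ltr01).
  apply: (le_trans _ (ltW M1)).
  rewrite ord1 -(@expr_le1 _ 2)// real_normK ?num_real// -u1 bilin1E (bigD1 i)//=.
  by rewrite -expr2 lerDl sumr_ge0// => j _; rewrite -expr2 sqr_ge0.
apply: (@closed_comp _ _ (fun u : 'rV[R]_n => bilin 1%:M u u) [set x | x = 1]).
  by move=> u _; exact: continuous_bilin.
exact: closed_eq.
Qed.

Lemma rayleigh_max_eigenvalue (R : realType) n (S : 'M[R]_n) :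
  (0 < n)%N -> S^T = S ->
  exists2 mu, eigenvalue S mu &
    forall u, bilin S u u <= mu * bilin 1%:M u u.
Proof.
case: n S => // n S _ hS.
have [||c] := EVT_max_rV _ (@compact_sphere R n.+1) (f := fun u => bilin S u u).
- exists (delta_mx 0 0); rewrite /= bilin1E (bigD1 0)//= big1 => [|i i0].
    by rewrite addr0 !mxE eqxx mulr1.
  by rewrite !mxE (negPf i0) mulr0.
- by apply: continuous_subspaceT; exact: continuous_bilin.
rewrite inE /= => c1 cmax.
(* The maximum over the sphere extends to all [u] by homogeneity, after scaling by the inverse
   Euclidean norm [t]. *)
have ray u : bilin S u u <= bilin S c c * bilin 1%:M u u.
  have [->|u0] := eqVneq u 0; first by rewrite /bilin !mul0mx !mxE mulr0.
  have N0 : 0 < bilin 1%:M u u by rewrite lt_def bilin1_eq0 u0 bilin1_ge0.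
  have s0 : Num.sqrt (bilin 1%:M u u) != 0 by rewrite sqrtr_eq0 -ltNge.
  pose t := (Num.sqrt (bilin 1%:M u u))^-1.
  have tZ T : bilin T (t *: u) (t *: u) = bilin T u u / bilin 1%:M u u.
    rewrite /bilin linearZ /= -!scalemxAl -!scalemxAr scalerA mxE mulrC.
    by rewrite /t -invfM -expr2 sqr_sqrtr// ltW.
  have := cmax (t *: u); rewrite inE /= tZ divff ?gt_eqF// => /(_ erefl).
  by rewrite tZ ler_pdivrMr.
exists (bilin S c c) => //.
apply/eigenvalueP; exists c; last by rewrite -bilin1_eq0 c1 oner_eq0.
have BE w : bilin ((bilin S c c)%:M - S) w w =
    bilin S c c * bilin 1%:M w w - bilin S w w.
  rewrite {1}/bilin mulmxBr mulmxBl mul_mx_scalar -scalemxAl [LHS]mxE.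
  by rewrite [X in X + _]mxE [X in _ + X]mxE {3}/bilin mulmx1.
have /eqP : c *m ((bilin S c c)%:M - S) = 0.
  apply: bilin_isotropic => [|w|]; last by rewrite BE c1 mulr1 subrr.
    by rewrite linearB /= tr_scalar_mx hS.
  by rewrite BE subr_ge0.
by rewrite mulmxBr mul_mx_scalar subr_eq0 => /eqP.
Qed.

(** * Euclidean norm and largest singular value *)

Lemma sqr_enorm (R : realType) n (x : 'cV[R]_n) :
  enorm x ^+ 2 = \sum_i x i 0 ^+ 2.
Proof. by rewrite sqr_sqrtr// sumr_ge0// => i _; rewrite sqr_ge0. Qed.

Lemma enorm_ge0 (R : realType) n (x : 'cV[R]_n) : 0 <= enorm x.
Proof. exact: sqrtr_ge0. Qed.

Lemma sqr_enorm_bilin (R : realType) n (x : 'cV[R]_n) :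
  enorm x ^+ 2 = bilin 1%:M x^T x^T.
Proof.
by rewrite sqr_enorm bilin1E; apply: eq_bigr => i _; rewrite mxE expr2.
Qed.

Lemma sqr_enorm_mulmx (R : realType) m n (M : 'M[R]_(m, n)) (x : 'cV[R]_n) :
  enorm (M *m x) ^+ 2 = bilin (M^T *m M) x^T x^T.
Proof. by rewrite sqr_enorm_bilin /bilin mulmx1 !trmxK trmx_mul !mulmxA. Qed.

Lemma enormD (R : realType) n (x y : 'cV[R]_n) :
  enorm (x + y) <= enorm x + enorm y.
Proof.
have x0 := enorm_ge0 x; have y0 := enorm_ge0 y.
rewrite -(@ler_pXn2r _ 2)// ?nnegrE ?addr_ge0 ?enorm_ge0//.
have -> : enorm (x + y) ^+ 2 =
    enorm x ^+ 2 + 2 * bilin 1%:M x^T y^T + enorm y ^+ 2.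
  have := @bilinDZ R n 1%:M 1 x^T y^T (trmx1 _ _).
  by rewrite !sqr_enorm_bilin scale1r -linearD /= => ->; ring.
rewrite sqrrD lerD2r lerD2l -[leRHS]mulr_natl ler_pM2l//.
rewrite (le_trans (ler_norm _))// -(@ler_pXn2r _ 2)// ?nnegrE ?mulr_ge0//.
rewrite real_normK ?num_real// exprMn !sqr_enorm_bilin.
apply: bilin_CauchySchwarz; first exact: trmx1.
exact: bilin1_ge0.
Qed.

Lemma max_singular_value_ge0 (R : realType) m n (M : 'M[R]_(m, n)) :
  0 <= max_singular_value M.
Proof.
(* A set without a supremum has [sup] equal to 0 by convention. *)
rewrite /max_singular_value; have [[[s Ms] ub]|/sup_out->//] :=
  pselect (has_sup (singular_values M)).
by apply: le_trans (ub_le_sup ub Ms); case: Ms.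
Qed.

Lemma enorm_mulmx_le (R : realType) m n (M : 'M[R]_(m, n)) (x : 'cV[R]_n) :
  enorm (M *m x) <= max_singular_value M * enorm x.
Proof.
rewrite -(@ler_pXn2r _ 2)// ?nnegrE ?mulr_ge0 ?enorm_ge0//; last first.
  exact: max_singular_value_ge0.
(* For [n = 0] the sphere is empty and offers no maximiser, so this case is separate. *)
case: (posnP n) => [n0|n_gt0].
  have -> : M *m x = 0.
    by apply/colP => i; rewrite !mxE big1// => j; have := ltn_ord j; rewrite {2}n0.
  have -> : enorm (0 : 'cV[R]_m) = 0.
    by apply/eqP; rewrite -sqrf_eq0 sqr_enorm big1// => i _; rewrite mxE expr0n.
  by rewrite expr0n exprn_ge0// mulr_ge0 ?enorm_ge0// max_singular_value_ge0.
have MMT : (M^T *m M)^T = M^T *m M by rewrite trmx_mul trmxK.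
have MM0 w : 0 <= bilin (M^T *m M) w w.
  by rewrite -[w]trmxK -sqr_enorm_mulmx sqr_ge0.
have [mu mu_eig mu_max] := rayleigh_max_eigenvalue n_gt0 MMT.
have eigE t : eigenvalue (M^T *m M) t ->
    exists2 v, 0 < bilin 1%:M v v & t * bilin 1%:M v v = bilin (M^T *m M) v v.
  move=> /eigenvalueP[v vE v0]; exists v.
    by rewrite lt_def bilin1_eq0 v0 bilin1_ge0.
  by rewrite /bilin vE -scalemxAl [RHS]mxE mulmx1.
have mu_ge0 : 0 <= mu.
  have [v v0 vE] := eigE _ mu_eig.
  by rewrite -(pmulr_lge0 _ v0) vE.
(* The square of a singular value is a Rayleigh quotient, hence at most [mu]. Boundedness is what
   lets [sup] dominate the element [Num.sqrt mu]. *)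
have ub : ubound (singular_values M) (Num.sqrt mu).
  move=> s [s0 /eigE[v v0 vE]].
  rewrite -(@ler_pXn2r _ 2)// ?nnegrE// sqr_sqrtr//.
  by rewrite -(ler_pM2r v0) vE.
have muM : mu <= max_singular_value M ^+ 2.
  rewrite -[mu]sqr_sqrtr// ler_pXn2r ?nnegrE ?max_singular_value_ge0//.
  apply: ub_le_sup; first by exists (Num.sqrt mu).
  by split; rewrite ?sqr_sqrtr.
rewrite sqr_enorm_mulmx exprMn (le_trans (mu_max _))// -sqr_enorm_bilin.
by rewrite ler_wpM2r ?sqr_ge0.
Qed.

(** * Pathwise bound on the squared state *)

(* For [q = 0] the quotient [e ^+ 2 / q] is [0], which is harmless since then
   [e = 0]. *)
Lemma sqr_contraction_le (R : realType) (a delta q r X e N : R) :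
  0 <= a < 1 -> 0 <= delta -> 0 <= q -> delta + q <= (1 - a) * r ->
  (q = 0 -> e = 0) -> 0 <= N <= a * X + delta + e ->
  N ^+ 2 <= a * X ^+ 2 + r * (delta + e ^+ 2 / q).
Proof.
move=> /andP[a0 a1] d0 q0 dqr qe /andP[N0 Nle].
have a1' : 0 < 1 - a by rewrite subr_gt0.
apply: (@le_trans _ _ ((a * X + (delta + e)) ^+ 2)).
  by rewrite addrA ler_pXn2r// nnegrE (le_trans N0).
have jensen : (a * X + (delta + e)) ^+ 2 <=
    a * X ^+ 2 + (delta + e) ^+ 2 / (1 - a).
  rewrite -subr_ge0.
  have -> : a * X ^+ 2 + (delta + e) ^+ 2 / (1 - a)
      - (a * X + (delta + e)) ^+ 2 =
    a / (1 - a) * ((1 - a) * X - (delta + e)) ^+ 2 by field; lra.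
  by rewrite mulr_ge0 ?sqr_ge0// divr_ge0// ltW.
have titu : (delta + e) ^+ 2 <= (delta + q) * (delta + e ^+ 2 / q).
  have [q1|q1] := eqVneq q 0.
    by rewrite (qe q1) q1 expr0n /= mul0r !addr0 expr2.
  rewrite -subr_ge0.
  have -> : (delta + q) * (delta + e ^+ 2 / q) - (delta + e) ^+ 2 =
    delta * (e - q) ^+ 2 / q by field.
  by rewrite divr_ge0// mulr_ge0// sqr_ge0.
(* The hypothesis [delta + q <= (1 - a) * r] absorbs the denominator [1 - a] into the factor [r]. *)
apply: (le_trans jensen); rewrite lerD2l ler_pdivrMr//.
apply: (le_trans titu); rewrite [leRHS]mulrAC (mulrC r).
by rewrite ler_wpM2r// addr_ge0// divr_ge0// sqr_ge0.
Qed.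

(** The one-step contraction is iterated: what enters at step [j] is damped by the [k - 1 - j] steps
    that follow, which is the value of [rev_ord j]. *)
Lemma sqr_enorm_trajectory_le (R : realType) (nx nv nw : nat) (A : 'M[R]_nx)
    (D : 'M[R]_(nx, nv)) (E : 'M[R]_(nx, nw)) (d q r : R) (x : 'cV[R]_nx)
    (v : nat -> 'cV[R]_nv) (w : nat -> 'cV[R]_nw) (k : nat) :
  let a := max_singular_value A in let delta := max_singular_value D * d in
  a < 1 -> 0 <= d -> 0 <= q -> delta + q <= (1 - a) * r -> (q = 0 -> E = 0) ->
  (forall j, enorm (v j) <= d) ->
  enorm (trajectory A D E x v w k) ^+ 2 <=
  a ^+ k * enorm x ^+ 2 +
  r * \sum_(j < k) a ^+ rev_ord j * (delta + enorm (E *m w j) ^+ 2 / q).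
Proof.
move=> a delta a1 d0 q0 dqr qE vd.
have a0 : 0 <= a := max_singular_value_ge0 A.
have delta0 : 0 <= delta by rewrite mulr_ge0// max_singular_value_ge0.
elim: k => [|k IH]; first by rewrite big_ord0 mulr0 addr0 mul1r.
rewrite [trajectory _ _ _ _ _ _ _]/=.
set X := trajectory A D E x v w k in IH *.
apply: (@le_trans _ _
  (a * enorm X ^+ 2 + r * (delta + enorm (E *m w k) ^+ 2 / q))).
  apply: sqr_contraction_le => //.
  - by rewrite a0.
  - move=> /qE ->; rewrite mul0mx; apply/eqP; rewrite -sqrf_eq0 sqr_enorm.
    by rewrite big1// => i _; rewrite mxE expr0n.
  - rewrite enorm_ge0 (le_trans (enormD _ _))// lerD2r (le_trans (enormD _ _))//.
    rewrite lerD ?enorm_mulmx_le// (le_trans (enorm_mulmx_le _ _))//.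
    by rewrite ler_wpM2l// max_singular_value_ge0.
rewrite big_ord_recr /= subnn expr0 mul1r [in leRHS]mulrDr addrA lerD2r.
apply: (le_trans (ler_wpM2l a0 IH)).
rewrite mulrDr mulrA -exprS lerD2l mulrCA le_eqVlt; apply/orP; left.
apply/eqP; congr (_ * _); rewrite mulr_sumr; apply: eq_bigr => j _.
by rewrite mulrA -exprS /= subSS subnSK.
Qed.

(** * Bounding CVaR through a nonnegative majorant *)

(* The smaller function need not be measurable, which spares a proof that the
   closed-loop state is a measurable function of the disturbances. *)
Lemma expectation_ge0_le (R : realType) dT (T : measurableType dT)
    (P : probability T R) (X Y : T -> R) :
  (forall w, 0 <= X w) -> (forall w, X w <= Y w) -> ('E_P[X] <= 'E_P[Y])%E.
Proof.
move=> X0 XY; have Y0 w : 0 <= Y w by rewrite (le_trans (X0 w)).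
rewrite unlock !ge0_integralTE => [|w|w]; rewrite ?lee_fin//.
(* The integral of a nonnegative function is a supremum over simple functions below it, and these
   also lie below [Y]. *)
apply: ereal_sup_le => _ [h hX <-]; exists h => // w /=.
by rewrite (le_trans (hX w))// lee_fin.
Qed.

(** [beta] is a candidate in the infimum, and the positive part of [L - beta] stays below [G]
    because [G] is nonnegative. *)
Lemma CVaR_le (R : realType) dT (T : measurableType dT) (P : probability T R)
    (eps beta g : R) (L G : T -> R) :
  0 < eps -> (forall w, 0 <= G w) -> (forall w, L w <= beta + G w) ->
  ('E_P[G] = g%:E)%E -> (CVaR P eps L <= (beta + eps^-1 * g)%:E)%E.
Proof.
move=> eps0 G0 LG Gg.
apply: (@le_trans _ _ (beta%:E + (eps^-1)%:E *
    'E_P[fun w => Num.max (L w - beta)%R 0%R])%E).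
  by apply: ereal_inf_lbound; exists beta.
rewrite EFinD EFinM -Gg leeD2l// lee_wpmul2l ?lee_fin ?invr_ge0 ?(ltW eps0)//.
apply: expectation_ge0_le => w; first by rewrite le_max lexx orbT.
by rewrite ge_max G0 lerBlDl LG.
Qed.

(** * Means of quadratic functions of the disturbance *)

(** Integrability is bundled with the value so that linearity of expectation composes. *)
Definition has_mean (R : realType) dT (T : measurableType dT)
    (P : probability T R) (X : T -> R) (e : R) : Prop :=
  X \in Lfun P 1 /\ ('E_P[X] = e%:E)%E.

Lemma has_meanZ (R : realType) dT (T : measurableType dT)
    (P : probability T R) (X : T -> R) (c e : R) :
  has_mean P X e -> has_mean P (fun w => c * X w) (c * e).
Proof.
move=> [X1 Xe].
have -> : (fun w => c * X w) = c \o* X by apply/funext => w; rewrite /= mulrC.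
split; last by rewrite expectationZl// Xe.
apply/Lfun1_integrable; rewrite (_ : _ \o _ = fun w => (X w)%:E * c%:E)%E//.
by apply: integrableZr => //; exact/Lfun1_integrable.
Qed.

Lemma has_mean_sum (R : realType) dT (T : measurableType dT)
    (P : probability T R) (I : Type) (s : seq I) (X : I -> T -> R)
    (e : I -> R) :
  (forall i, has_mean P (X i) (e i)) ->
  has_mean P (fun w => \sum_(i <- s) X i w) (\sum_(i <- s) e i).
Proof.
move=> Xe; elim: s => [|i s [IH1 IHe]].
  rewrite big_nil; under eq_fun do rewrite big_nil.
  by split; [exact: Lfun_cst|rewrite expectation_cst].
rewrite big_cons; under eq_fun do rewrite big_cons.
have [Xi1 Xie] := Xe i.
split; first exact: rpredD.
by rewrite expectationD// Xie IHe.
Qed.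

(** With zero means a covariance is a second moment, and the diagonal blocks of the Kronecker
    product are copies of [Sigma]. *)
Lemma has_mean_disturbance (R : realType) (nw k : nat) (Sigma : 'M[R]_nw)
    (P : probability (Rvec R (k * nw)) R) (j : 'I_k) (a b : 'I_nw) :
  ambiguity_set Sigma k P ->
  has_mean P (fun w => disturbance w j a 0 * disturbance w j b 0) (Sigma a b).
Proof.
move=> [L2 E0 cov].
have dE i w : disturbance w j i 0 = tnth w (mxtens_index (j, i)).
  by rewrite mxE (tnth_nth 0).
under eq_fun do rewrite !dE.
have := cov (mxtens_index (j, a)) (mxtens_index (j, b)).
rewrite tensmxE mxE eqxx mul1r => covE.
have L1 := Lfun2_mul_Lfun1 (L2 (mxtens_index (j, a))) (L2 (mxtens_index (j, b))).
split => //; move: covE; rewrite covariance.unlock !E0 /=.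
move=> <-; congr (expectation P _); apply/funext => w.
by rewrite /= !fctE /= !subr0.
Qed.

Lemma has_mean_sqr_enorm (R : realType) (nx nw k : nat) (Sigma : 'M[R]_nw)
    (E : 'M[R]_(nx, nw)) (P : probability (Rvec R (k * nw)) R) (j : 'I_k) :
  ambiguity_set Sigma k P ->
  has_mean P (fun w => enorm (E *m disturbance w j) ^+ 2)
    (\tr (Sigma *m E^T *m E)).
Proof.
move=> hP.
have -> : (fun w => enorm (E *m @disturbance _ nw k w j) ^+ 2) =
    (fun w => \sum_a \sum_b (E^T *m E) b a *
       (disturbance w j a 0 * disturbance w j b 0)).
  apply/funext => w; rewrite sqr_enorm_mulmx bilinE exchange_big.
  apply: eq_bigr => a _; apply: eq_bigr => b _; rewrite ![_^T 0 _]mxE.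
  by rewrite mulrAC mulrC (mulrC (disturbance w j b 0)).
have -> : \tr (Sigma *m E^T *m E) =
    \sum_a \sum_b (E^T *m E) b a * Sigma a b.
  rewrite -mulmxA; apply: eq_bigr => a _; rewrite mxE.
  by apply: eq_bigr => b _; rewrite mulrC.
apply: has_mean_sum => a; apply: has_mean_sum => b.
exact/has_meanZ/has_mean_disturbance.
Qed.

(** * The trace as a sum of quadratic forms in the rows of [E] *)

(* The double transpose matches the shape of [posdef]. *)
Lemma mxtrace_quadratic (R : realType) nx nw (S : 'M[R]_nw)
    (E : 'M[R]_(nx, nw)) :
  \tr (S *m E^T *m E) = \sum_i ((row i E)^T^T *m S *m (row i E)^T) 0 0.
Proof.
rewrite mxtrace_mulC mulmxA; apply: eq_bigr => i _.
by rewrite trmxK -row_mul !mxE; apply: eq_bigr => j _; rewrite !mxE.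
Qed.

Lemma posdef_ge0 (R : realType) n (S : 'M[R]_n) (x : 'cV[R]_n) :
  posdef S -> 0 <= (x^T *m S *m x) 0 0.
Proof.
move=> [_ S0]; have [->|/S0/ltW//] := eqVneq x 0.
by rewrite mulmx0 mxE.
Qed.

Lemma posdef_mxtrace_ge0 (R : realType) nx nw (S : 'M[R]_nw)
    (E : 'M[R]_(nx, nw)) : posdef S -> 0 <= \tr (S *m E^T *m E).
Proof.
by move=> S0; rewrite mxtrace_quadratic sumr_ge0// => i _; exact: posdef_ge0.
Qed.

Lemma posdef_mxtrace_eq0 (R : realType) nx nw (S : 'M[R]_nw)
    (E : 'M[R]_(nx, nw)) : posdef S -> \tr (S *m E^T *m E) = 0 -> E = 0.
Proof.
move=> S0 /eqP; rewrite mxtrace_quadratic psumr_eq0 => [/allP E0|i _]; last first.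
  exact: posdef_ge0.
apply/row_matrixP => i; rewrite row0; apply/eqP/negPn/negP => Ei.
have := E0 i; rewrite mem_index_enum => /(_ isT); apply/negP.
by rewrite gt_eqF//; apply: (proj2 S0); rewrite -trmx0 (inj_eq trmx_inj).
Qed.

(** * Continuity of the loss and invariance of the ball *)

Lemma continuous_sqr_enorm (R : realType) n :
  continuous (fun x : 'cV[R]_n => enorm x ^+ 2).
Proof.
under eq_fun do rewrite sqr_enorm.
apply: continuous_sumr => i.
have cx : continuous (fun x : 'cV[R]_n => x i 0) by exact: coord_continuous.
by move=> x; apply: (continuousM (cx x) (cx x)).
Qed.

Theorem mainTheorem4 (R : realType) (nx nv nw : nat)
    (A : 'M[R]_nx) (D : 'M[R]_(nx, nv)) (E : 'M[R]_(nx, nw))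
    (Sigma_w : 'M[R]_nw) (eps d r : R)
    (hSigma : posdef Sigma_w)
    (heps : 0 < eps < 1)
    (hd : 0 <= d)
    (hA : max_singular_value A < 1)
    (hreach : reachable A E)
    (hr : 0 < r)
    (hr2 : r ^+ 2 >= 1 / (1 - max_singular_value A) ^+ 2
             * (max_singular_value D * d
                + Num.sqrt (1 / eps * \tr (Sigma_w *m E^T *m E))) ^+ 2) :
  wc_CVaR_invariant A D E Sigma_w [set v : 'cV[R]_nv | enorm v <= d] eps
    (fun x : 'cV[R]_nx => enorm x ^+ 2 - r ^+ 2).
Proof.
set a := max_singular_value A in hA hr2 *.
set delta := max_singular_value D * d in hr2.
set tau := \tr _ in hr2; set q := Num.sqrt _ in hr2.
have eps0 : 0 < eps by case/andP: heps.
have a0 : 0 <= a := max_singular_value_ge0 A.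
have a1' : 0 < 1 - a by rewrite subr_gt0.
have delta0 : 0 <= delta by rewrite mulr_ge0// max_singular_value_ge0.
have q0 : 0 <= q := sqrtr_ge0 _.
have tau0 : 0 <= tau := posdef_mxtrace_ge0 E hSigma.
have q2 : q ^+ 2 = eps^-1 * tau.
  by rewrite sqr_sqrtr div1r// mulr_ge0// invr_ge0 ltW.
have qE : q = 0 -> E = 0.
  move=> q00; apply: (posdef_mxtrace_eq0 hSigma); apply/eqP.
  move/esym/eqP: q2; rewrite q00 expr0n /= mulf_eq0 invr_eq0 gt_eqF//.
(* The square root of [hr2], both sides being nonnegative. *)
have dqr : delta + q <= (1 - a) * r.
  have m0 : 0 <= delta + q by rewrite addr_ge0.
  have ar0 : 0 <= (1 - a) * r by rewrite mulr_ge0 ?ltW.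
  rewrite -(@ler_pXn2r _ 2)//.
  by rewrite exprMn -ler_pdivrMl ?exprn_gt0// -div1r.
split.
  move=> x; apply: (@continuousB _ _ _ (fun x => enorm x ^+ 2) (fun=> r ^+ 2)).
    exact: continuous_sqr_enorm.
  exact: cst_continuous.
move=> x; rewrite subr_le0 => xr v vadm k k0.
apply: ge_ereal_sup => _ [P hP <-].
pose S := \sum_(j < k) a ^+ rev_ord j.
have SE : (1 - a) * S = 1 - a ^+ k.
  rewrite /S (reindex_inj rev_ord_inj) /=.
  rewrite -[RHS]opprB subrX1 -mulNr opprB; congr (_ * _).
  by apply: eq_bigr => j _; rewrite -[j in RHS]rev_ordK.
have S0 : 0 <= S by rewrite sumr_ge0// => j _; rewrite exprn_ge0.
(* The deterministic part of the unrolled bound, with the initial norm replaced by its largest value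
   [r]; [G] is the random part. *)
pose beta := a ^+ k * r ^+ 2 + r * (delta * S) - r ^+ 2.
pose G (w : Rvec R (k * nw)) :=
  r * \sum_(j < k)
    a ^+ rev_ord j * (q^-1 * enorm (E *m @disturbance _ nw k w j) ^+ 2).
have [_ GE] : has_mean P G (r * \sum_(j < k) a ^+ rev_ord j * (q^-1 * tau)).
  apply/has_meanZ/has_mean_sum => j.
  by do 2!apply: has_meanZ; exact: has_mean_sqr_enorm.
apply: (@le_trans _ _ (beta + eps^-1 *
    (r * \sum_(j < k) a ^+ rev_ord j * (q^-1 * tau)))%:E).
  apply: CVaR_le GE => // w.
    rewrite mulr_ge0 ?(ltW hr)// sumr_ge0// => j _.
    by rewrite mulr_ge0 ?exprn_ge0// mulr_ge0 ?invr_ge0 ?sqr_ge0.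
  have := sqr_enorm_trajectory_le x (disturbance w) k hA hd q0 dqr qE
    (fun j => (vadm j).1 (history w j)).
  rewrite -/(state_after A D E x v w) => /le_trans le_state.
  rewrite lerBlDr; apply: le_state.
  have -> : beta + G w + r ^+ 2 = a ^+ k * r ^+ 2 + (r * (delta * S) + G w).
    by rewrite /beta; ring.
  apply: lerD; first by rewrite ler_wpM2l ?exprn_ge0.
  rewrite -mulrDr ler_wpM2l ?(ltW hr)// le_eqVlt; apply/orP; left; apply/eqP.
  rewrite /S mulr_sumr -big_split /=; apply: eq_bigr => j _.
  by rewrite mulrDr (mulrC delta) (mulrC q^-1).
rewrite lee_fin -mulr_suml -/S.
have -> : beta + eps^-1 * (r * (S * (q^-1 * tau))) =
    r * (S * (delta + q)) - (1 - a ^+ k) * r ^+ 2.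
  have -> : eps^-1 * (r * (S * (q^-1 * tau))) = r * (S * (q^-1 * q ^+ 2)).
    by rewrite q2; ring.
  (* This also holds at [q = 0], where the inverse is 0 by convention. *)
  have -> : q^-1 * q ^+ 2 = q.
    have [->|qn0] := eqVneq q 0; first by rewrite expr0n mulr0.
    by rewrite expr2 mulKf.
  by rewrite /beta; ring.
(* Writing [1 - a ^+ k] as [(1 - a) * S] gives both sides the factor [r * S], leaving [dqr]. *)
rewrite subr_le0 -SE (_ : _ * S * _ = r * (S * ((1 - a) * r))); last by ring.
by rewrite !ler_wpM2l// ltW.
Qed.
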